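(* Let $\lambda$ be a partition. Suppose that $\theta=1$ and that $\bar m=(M,0)$ for some positive integer $M\ge\ell(\lambda)$. Then $$f^{(\bar m)}_\lambda(x,-\tilde x)=S_\lambda(x,\tilde x).$$
   Context: Let $n,\tilde n$ be non-negative integers and $x=(x_1,\dots,x_n)$, $\tilde x=(\tilde x_1,\dots,\tilde x_{\tilde n})$ independent variables. $\ell(\lambda)$ is the number of non-zero parts of $\lambda$; $\lambda$ is regarded as an element of $\mathbb{Z}^M$ by padding with zeros. For $\theta=1$ and $\bar m=(M,0)$, the polynomials $f^{(\bar m)}_a(x,\tilde x)$, $a\in\mathbb{Z}^M$, are defined by the expansion $$\prod_{1\le j<l\le M}(1-y_l/y_j)\prod_{j=1}^M\frac{\prod_{I=1}^{\tilde n}(1-\tilde x_Iy_j)}{\prod_{i=1}^n(1-x_iy_j)}=\sum_{a\in\mathbb{Z}^M}f^{(\bar m)}_a(x,\tilde x)y^a,$$ valid when $|y_1|>\dots>|y_M|$ and $|y_1|<|x_i|^{-1},|\tilde x_I|^{-1}$ for all $i,I$. (This is the specialization of the general definition $\prod_{j<l}(1-y_l/y_j)^{-(-\theta)^{1-q(j)-q(l)}}\prod_{i,j}(1-x_iy_j)^{(-\theta)^{1-p(i)-q(j)}}=\sum_af^{(\bar m)}_a(x)y^a$ with $x_{n+I}=\tilde x_I$, $p(i)=0$ for $i\le n$ and $1$ for $i>n$, $q(j)=0$ for $j\le m$ and $1$ for $j>m$.) The notation $f(x,-\tilde x)$ means substituting $-\tilde x_I$ for each $\tilde x_I$. The polynomials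 $s_k(x,\tilde x)$ are defined by $\prod_{i=1}^n(1-x_iy)^{-1}\prod_{I=1}^{\tilde n}(1+\tilde x_Iy)=\sum_{k\ge0}s_k(x,\tilde x)y^k$, with $s_k=0$ for $k<0$, and the super Schur polynomial is $S_\lambda(x,\tilde x)=\det\bigl(s_{\lambda_i-i+j}(x,\tilde x)\bigr)_{1\le i,j\le\ell(\lambda)}$. *)

(* Defs.v *)
From HB Require Import structures.
From mathcomp Require Import all_boot all_order all_algebra.
From mathcomp Require Import classical_sets cardinality fsbigop.
From mathcomp Require Import mpoly.

Set Implicit Arguments.
Unset Strict Implicit.
Unset Printing Implicit Defensive.

Import Order.TTheory GRing.Theory Num.Theory.

Local Open Scope ring_scope.

(* Formal Laurent series sum_(a in E) F a * y^a, with exponents in an additive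
   group E: E = int for one variable, E = {ffun 'I_M -> int} (i.e. Z^M) for
   y_1, ..., y_M. *)
Definition lseries (E : zmodType) (A : Type) := E -> A.

Section LaurentSeries.
Variables (E : zmodType) (A : comNzRingType).
Implicit Types (F G : lseries E A) (e a : E) (c : A).

Definition lone : lseries E A := fun a => (a == 0)%:R.

(* The Cauchy product. The sum is the finitely supported sum of fsbigop, which
   is 0 by convention when infinitely many terms are nonzero; this never occurs
   below, where all factors have exponents bounded below in each variable. *)
Definition lmul F G : lseries E A :=
  fun a => \sum_(b \in [set: E]) F b * G (a - b).

(* 1 + c y^e *)
Definition lbinom c e : lseries E A :=
  fun a => (a == 0)%:R + c * (a == e)%:R.

(* The expansion sum_(k >= 0) c^k y^(k e) of (1 - c y^e)^-1, |c y^e| < 1.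
   Below, e is a standard basis vector (or 1 in int), so each coefficient has at most
   one term. *)
Definition lgeom c e : lseries E A :=
  fun a => \sum_(k \in [set k : nat | e *+ k = a]%classic) c ^+ k.

End LaurentSeries.

(* The exponent of the monomial y_j. *)
Definition evar (M : nat) (j : 'I_M) : {ffun 'I_M -> int} :=
  [ffun i => (i == j)%:Z].

Section Polynomials.
Variables (R : comNzRingType) (n nt : nat).

Definition xvar (i : 'I_n) : {mpoly R[n + nt]} := 'X_(lshift nt i).
Definition xtvar (I : 'I_nt) : {mpoly R[n + nt]} := 'X_(rshift n I).

(* prod_(j < l) (1 - y_l / y_j) *
   prod_j (prod_I (1 - xt_I y_j) / prod_i (1 - x_i y_j)).
   The first product is a Laurent polynomial; in the region
   |y_1| > ... > |y_M|, |x_i y_1| < 1, the factors (1 - x_i y_j)^-1 expand as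
   geometric series in nonnegative powers of y_j. *)
Definition f_genfun (M : nat) : lseries {ffun 'I_M -> int} {mpoly R[n + nt]} :=
  lmul
    (\big[@lmul _ _/@lone _ _]_(p : 'I_M * 'I_M | (p.1 < p.2)%N)
       lbinom (-1) (evar p.2 - evar p.1))
    (\big[@lmul _ _/@lone _ _]_(j < M)
       lmul (\big[@lmul _ _/@lone _ _]_(I < nt) lbinom (- xtvar I) (evar j))
            (\big[@lmul _ _/@lone _ _]_(i < n) lgeom (xvar i) (evar j))).

(* f^{(M,0)}_a(x, xt) at theta = 1 *)
Definition f_poly (M : nat) (a : {ffun 'I_M -> int}) : {mpoly R[n + nt]} :=
  f_genfun a.

(* p(x, xt) |-> p(x, -xt) *)
Definition neg_xt (p : {mpoly R[n + nt]}) : {mpoly R[n + nt]} :=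
  p \mPo [tuple match split v with
                | inl i => xvar i
                | inr k => - xtvar k
                end | v < n + nt].

(* prod_i (1 - x_i y)^-1 * prod_I (1 + xt_I y) *)
Definition s_genfun : lseries int {mpoly R[n + nt]} :=
  lmul (\big[@lmul _ _/@lone _ _]_(i < n) lgeom (xvar i) 1)
       (\big[@lmul _ _/@lone _ _]_(I < nt) lbinom (xtvar I) 1).

Definition s_poly (k : int) : {mpoly R[n + nt]} :=
  if 0 <= k then s_genfun k else 0.

(* Partitions are sequences of naturals, with trailing zeros allowed. *)
Definition plength (la : seq nat) : nat := count (fun p => 0 < p)%N la.

Definition super_schur (la : seq nat) : {mpoly R[n + nt]} :=
  \det (\matrix_(i < plength la, j < plength la)
          s_poly ((nth 0%N la i)%:Z - i%:Z + j%:Z)).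

End Polynomials.

Definition is_partition (la : seq nat) : bool := sorted geq la.

(* A partition as an element of Z^M. *)
Definition pad (M : nat) (la : seq nat) : {ffun 'I_M -> int} :=
  [ffun j : 'I_M => (nth 0%N la j)%:Z].

(* Main.v *)
Require Import Defs.
From HB Require Import structures.
From mathcomp Require Import all_boot all_order all_algebra.
From mathcomp Require Import perm.
From mathcomp Require Import boolp classical_sets fsbigop.
From mathcomp Require Import ssrcomplements mpoly.

(** This is the Jacobi-Trudi argument in generating-function form. Write
    [g(y) = sum_k g_k y^k] for the series
    [prod_I (1 - xt_I y) / prod_i (1 - x_i y)]. It is a power series in one
    variable with constant term 1, and the second factor of the generating
    function of the [f_a] is [prod_j g(y_j)], whose coefficient at [y^b] is
    [prod_j g_(b_j)] ([along_prod]).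

    The first factor is a Vandermonde determinant up to a monomial:
    [prod_(j<l) (1 - y_l/y_j) = y^(-delta) prod_(j<l) (y_j - y_l)] with
    [delta = (M-1, ..., 1, 0)]. Expanding that determinant over permutations,
    each monomial only shifts the coefficients of [prod_j g(y_j)], and the signed
    sum that results is the determinant of [g_(a_i - i + j)] of size [M]
    ([jacobi_trudi]).

    For [a = lambda], the rows of index at least [l(lambda)] contain the entries
    [g_(j - i)], so that they are unitriangular and the determinant is already
    that of the leading block of size [l(lambda)] ([det_jacobi_trudi_size]).
    Finally [xt -> -xt] is a ring morphism that turns [g] into the generating
    function of the [s_k] ([neg_xt_genfun]).

    The Cauchy product is a finite-support sum, hence not associative in
    general. What is needed of associativity holds because the factors
    [1 - y_l/y_j] are Laurent polynomials ([lmul_lbinomA]); this lets their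
    product be replaced by the action of a polynomial on Laurent series, in
    which the Vandermonde identity for polynomials applies
    ([lmul_lbinom_prod]). *)

Import GRing.Theory.

Local Open Scope ring_scope.

(** * Cauchy products of formal Laurent series *)

Section CauchyProduct.
Variables (E : zmodType) (A : comNzRingType).
Implicit Types (F G : lseries E A) (a b e : E) (c : A).

(** Any finite list that contains the support of the summand computes the
    product; every later evaluation chooses such a list. *)
Lemma lmul_finsum (r : seq E) F G a :
  uniq r -> (forall b, b \notin r -> F b * G (a - b) = 0) ->
  lmul F G a = \sum_(b <- r) F b * G (a - b).
Proof.
move=> ru r0; rewrite /lmul (fsbigE r) //; last by move=> b _; exact: r0.
by apply: eq_bigl => b; rewrite in_setT.
Qed.

(** The substitution [b -> a - b] is a bijection, so it preserves finiteness of
    the support, and both sides take the default value 0 at the same time. *)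
Lemma lmulC F G : lmul F G = lmul G F.
Proof.
apply/funext => a; rewrite /lmul (reindex_fsbigT (fun b => a - b)).
  by apply: eq_fsbigr => b _; rewrite subKr mulrC.
by exists (fun b => a - b) => b; rewrite subKr.
Qed.

Lemma lmul_eq0 F G a : (forall b, F b * G (a - b) = 0) -> lmul F G a = 0.
Proof. by move=> FG0; rewrite (@lmul_finsum [::]) // big_nil. Qed.

Lemma lmul_lone F : lmul (@lone E A) F = F.
Proof.
apply/funext => a; rewrite (@lmul_finsum [:: 0]) //; last first.
  by move=> b; rewrite inE /lone => /negbTE->; rewrite mul0r.
by rewrite big_seq1 /lone eqxx mul1r subr0.
Qed.

(** Finite support, i.e. Laurent polynomials. *)
Definition lfin F := exists r : seq E, forall b, b \notin r -> F b = 0.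

Lemma lfin_lone : lfin (@lone E A).
Proof. by exists [:: 0] => b; rewrite inE /lone => /negbTE->. Qed.

Lemma lmul_lbinom c e F a :
  e != 0 -> lmul (lbinom c e) F a = F a + c * F (a - e).
Proof.
move=> e0; rewrite (@lmul_finsum [:: 0; e]) /=; last 2 first.
- by rewrite inE eq_sym e0.
- move=> b; rewrite !inE negb_or => /andP[/negbTE b0 /negbTE be].
  by rewrite /lbinom b0 be mulr0 addr0 mul0r.
rewrite !big_cons big_nil /lbinom !eqxx (negbTE e0) eq_sym (negbTE e0).
by rewrite subr0 mulr0 mulr1 add0r !addr0 mul1r.
Qed.

Lemma lfin_lbinom c e F : e != 0 -> lfin F -> lfin (lmul (lbinom c e) F).
Proof.
move=> e0 [r r0]; exists (r ++ map (+%R^~ e) r) => b.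
rewrite mem_cat negb_or => /andP[br bre]; rewrite lmul_lbinom // r0 // add0r.
rewrite r0 ?mulr0 //; apply: contra bre => bre.
by apply/mapP; exists (b - e) => //; rewrite subrK.
Qed.

(** Splitting the sum for [(F + c y^e F) G] into two is legitimate because [F],
    hence each of the two summands, has finite support. *)
Lemma lmul_lbinomA c e F G :
  e != 0 -> lfin F -> lmul (lmul (lbinom c e) F) G = lmul (lbinom c e) (lmul F G).
Proof.
move=> e0 [r r0]; apply/funext => a; rewrite (lmul_lbinom _ _ (lmul F G)) //.
(* [s] contains the supports of both F and y^e F. *)
pose s := undup (r ++ map (+%R^~ e) r).
have su : uniq s by rewrite undup_uniq.
have s0 b : b \notin s -> F b = 0 /\ F (b - e) = 0.
  rewrite mem_undup mem_cat negb_or => /andP[br bre]; split; rewrite r0 //.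
  apply: contra bre => bre.
  by apply/mapP; exists (b - e) => //; rewrite subrK.
rewrite (@lmul_finsum s) //; last first.
  by move=> b /s0[F0 F1]; rewrite lmul_lbinom // F0 F1 mulr0 addr0 mul0r.
rewrite (@lmul_finsum s F) //; last by move=> b /s0[-> _]; rewrite mul0r.
rewrite (@lmul_finsum (map (fun b => b - e) s)); last 2 first.
- by rewrite map_inj_uniq //; apply: addIr.
- move=> b bs; suff [_] : F (b + e) = 0 /\ F (b + e - e) = 0.
    by rewrite addrK => ->; rewrite mul0r.
  by apply: s0; apply: contra bs => bs; apply/mapP; exists (b + e); rewrite ?addrK.
rewrite big_map mulr_sumr -big_split /=; apply: eq_bigr => b _.
rewrite lmul_lbinom // mulrDl mulrA; congr (_ + _ * G _).
by rewrite opprB addrA subrK.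
Qed.

End CauchyProduct.

Arguments lfin {E A}.

(** * Power series in one variable with constant term 1 *)

Section OneVariable.
Variables (A : comNzRingType).
Implicit Types (F G : lseries int A).

Lemma lgeom1E (c : A) (k : int) :
  lgeom c 1 k = if k is Posz m then c ^+ m else 0.
Proof.
rewrite /lgeom; case: k => k.
  rewrite (fsbigE [:: k]) //=; last 2 first.
  - by move=> i /=; rewrite inE => /eqP->; rewrite natz.
  - by move=> i /=; rewrite natz inE => -[->]; rewrite eqxx.
  by rewrite big_cons big_nil ifT ?addr0 // inE /= natz.
by rewrite fsbig1 // => i /=; rewrite natz.
Qed.

(** The power series in [1 + y A[[y]]], extended by 0 to negative exponents. *)
Definition normalized F := F 0 = 1 /\ forall k : nat, F (Negz k) = 0.

Lemma lmul_nat F G (k : nat) : normalized F -> normalized G ->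
  lmul F G k = \sum_(i < k.+1) F i * G (k - i)%N.
Proof.
move=> [_ F0] [_ G0]; rewrite (@lmul_finsum _ _ (map Posz (iota 0 k.+1))); last 2 first.
- by rewrite map_inj_uniq ?iota_uniq // => i j [].
- case=> i; last by rewrite F0 mul0r.
  rewrite mem_map ?mem_iota; last by move=> x y [].
  rewrite /= add0n ltnS -ltnNge => ki.
  suff -> : k%:Z - i%:Z = Negz (i - k).-1 by rewrite G0 mulr0.
  by rewrite NegzE prednK ?subn_gt0 // -subzn ?opprB // ltnW.
rewrite big_map -(big_mkord xpredT (fun i : nat => F i * G (k - i)%N)).
rewrite /index_iota subn0 !big_seq.
apply: eq_bigr => i; rewrite mem_iota add0n ltnS => /= ik.
by rewrite subzn.
Qed.

Lemma lmul_neg F G (k : nat) : normalized F -> normalized G ->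
  lmul F G (Negz k) = 0.
Proof.
move=> [_ F0] [_ G0]; apply: lmul_eq0 => -[] i; last by rewrite F0 mul0r.
have -> : Negz k - i%:Z = Negz (k + i) by rewrite !NegzE -opprD -PoszD -addSn.
by rewrite G0 mulr0.
Qed.

Lemma normalized_lmul F G : normalized F -> normalized G -> normalized (lmul F G).
Proof.
move=> uF uG; split=> [|k]; last exact: lmul_neg.
rewrite (@lmul_nat F G 0) // big_ord_recl big_ord0 addr0.
by case: uF uG => [-> _] [-> _]; rewrite mulr1.
Qed.

Lemma normalized_lbinom (c : A) : normalized (lbinom c 1).
Proof. by split=> [|k]; rewrite /lbinom /= mulr0 addr0. Qed.

Lemma normalized_lgeom (c : A) : normalized (lgeom c 1).
Proof. by split=> [|k]; rewrite lgeom1E. Qed.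

Lemma normalized_big (I : Type) (r : seq I) (F : I -> lseries int A) :
  (forall i, normalized (F i)) ->
  normalized (\big[@lmul _ _/@lone _ _]_(i <- r) F i).
Proof.
move=> uF; elim: r => [|i r IH]; first by rewrite big_nil.
by rewrite big_cons; exact: normalized_lmul.
Qed.

End OneVariable.

Arguments normalized {A}.

(** * Coefficientwise images under a ring morphism *)

Section Morphism.
Variables (A B : comNzRingType) (f : {rmorphism A -> B}).

(** A morphism commutes only with sums that are really finite, which for power
    series the bound on the exponents guarantees. *)
Lemma map_lmul (F G : lseries int A) (F' G' : lseries int B) : normalized F -> normalized F' ->
  normalized G -> normalized G' ->
  f \o F = F' -> f \o G = G' -> f \o lmul F G = lmul F' G'.
Proof.
move=> uF uF' uG uG' fF fG; apply/funext => -[] k /=; last first.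
  by rewrite !lmul_neg // rmorph0.
rewrite !lmul_nat // rmorph_sum; apply: eq_bigr => i _.
by rewrite -fF -fG rmorphM.
Qed.

Lemma map_lone : f \o @lone int A = @lone int B.
Proof. by apply/funext => k; rewrite /lone /= rmorph_nat. Qed.

Lemma map_lbinom (c : A) : f \o lbinom c (1 : int) = lbinom (f c) 1.
Proof. by apply/funext => k; rewrite /lbinom /= rmorphD rmorphM !rmorph_nat. Qed.

Lemma map_lgeom (c : A) : f \o lgeom c (1 : int) = lgeom (f c) 1.
Proof.
apply/funext => -[] k /=; rewrite !lgeom1E; [exact: rmorphXn | exact: rmorph0].
Qed.

Lemma map_lmul_big (I : Type) (r : seq I) (F : I -> lseries int A)
    (F' : I -> lseries int B) :
  (forall i, normalized (F i)) -> (forall i, normalized (F' i)) ->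
  (forall i, f \o F i = F' i) ->
  f \o \big[@lmul _ _/@lone _ _]_(i <- r) F i
    = \big[@lmul _ _/@lone _ _]_(i <- r) F' i.
Proof.
move=> uF uF' fF; elim: r => [|i r IH]; first by rewrite !big_nil map_lone.
by rewrite !big_cons; apply: map_lmul => //; exact: normalized_big.
Qed.

End Morphism.

(** * One-variable series as series in one of several variables *)

Section Axis.
Variables (A : comNzRingType) (M : nat).
Local Notation E := {ffun 'I_M -> int}.
Implicit Types (F G : lseries int A) (i j : 'I_M) (a : E).

(** The exponent of [y_j^k]. *)
Definition axis j (k : int) : E := [ffun i => if i == j then k else 0].

Lemma axisE j k : axis j k j = k.
Proof. by rewrite ffunE eqxx. Qed.

Lemma axis_inj j : injective (axis j).
Proof. by move=> k l /ffunP/(_ j); rewrite !axisE. Qed.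

Lemma axisB j : {morph axis j : k l / k - l}.
Proof. by move=> k l; apply/ffunP=> i; rewrite !ffunE; case: eqP; rewrite ?subr0. Qed.

Lemma axisD j : {morph axis j : k l / k + l}.
Proof. by move=> k l; apply/ffunP=> i; rewrite !ffunE; case: eqP; rewrite ?addr0. Qed.

Lemma axis0 j : axis j 0 = 0.
Proof. by apply/ffunP=> i; rewrite !ffunE if_same. Qed.

Lemma axisMn j k m : axis j k *+ m = axis j (k *+ m).
Proof.
by apply/ffunP=> i; rewrite ffunMnE !ffunE; case: eqP; rewrite ?mul0rn.
Qed.

Lemma evar_axis j : evar j = axis j 1.
Proof. by apply/ffunP=> i; rewrite !ffunE; case: eqP. Qed.

(** The series [F(y_j)] in the variables [y_1, ..., y_M]. *)
Definition along j F : lseries E A :=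
  fun a => if a == axis j (a j) then F (a j) else 0.

Lemma along_axis j F k : along j F (axis j k) = F k.
Proof. by rewrite /along axisE eqxx. Qed.

Lemma along_neq j F a : a != axis j (a j) -> along j F a = 0.
Proof. by rewrite /along => /negbTE->. Qed.

Lemma eq_along j (H : lseries E A) F :
  (forall k, H (axis j k) = F k) -> (forall a, a != axis j (a j) -> H a = 0) ->
  H = along j F.
Proof.
move=> HF H0; apply/funext => a; rewrite /along; case: eqP => [{1}->//|/eqP].
exact: H0.
Qed.

Lemma along_lone j : @lone E A = along j (@lone int A).
Proof.
apply: eq_along => [k|a]; rewrite /lone.
  by rewrite -(axis0 j) (inj_eq (@axis_inj j)).
by case: (eqVneq a 0) => [->|//]; rewrite ffunE axis0 eqxx.
Qed.

Lemma along_lbinom j (c : A) : lbinom c (evar j) = along j (lbinom c 1).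
Proof.
apply: eq_along => [k|a]; rewrite /lbinom evar_axis.
  by rewrite -(axis0 j) !(inj_eq (@axis_inj j)).
case: (eqVneq a 0) => [->|_]; first by rewrite ffunE axis0 eqxx.
have [->|_] := eqVneq a (axis j 1); first by rewrite axisE eqxx.
by rewrite mulr0 addr0.
Qed.

Lemma along_lgeom j (c : A) : lgeom c (evar j) = along j (lgeom c 1).
Proof.
apply: eq_along => [k|a]; rewrite /lgeom evar_axis.
  apply: eq_fsbigl; apply/seteqP; split=> i /=; rewrite axisMn; last by move->.
  by move/axis_inj.
move=> aj; rewrite fsbig1 // => i /=; rewrite axisMn => ia.
by move: aj; rewrite -ia axisE eqxx.
Qed.

(** Exponents off the [j]-th axis contribute zero terms only, and the embedding
    [axis j] is injective, so the two finite-support sums have the same terms,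
    finitely many or not. *)
Lemma along_lmul j F G : lmul (along j F) (along j G) = along j (lmul F G).
Proof.
apply: eq_along => [k|a aj]; last first.
  apply: lmul_eq0 => b; have [->|/along_neq->] := eqVneq b (axis j (b j)); last first.
    by rewrite mul0r.
  have [|/along_neq->] := eqVneq (a - axis j (b j)) (axis j ((a - axis j (b j)) j)).
    move: ((a - axis j (b j)) j) => c /(canRL (subrK _)).
    by rewrite -axisD => aE; move: aj; rewrite aE axisE eqxx.
  by rewrite mulr0.
rewrite /lmul -(@fsbig_widen _ _ _ _ (axis j @` setT)) //; last first.
  move=> b [_ /= nb]; rewrite along_neq ?mul0r //.
  by apply/eqP => bE; apply: nb; exists (b j).
rewrite fsbig_image; last by move=> x y _ _; exact: axis_inj.
by apply: eq_fsbigr => i _; rewrite -axisB !along_axis.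
Qed.

Lemma along_big (I : Type) (r : seq I) j (F : I -> lseries int A) :
  \big[@lmul _ _/@lone _ _]_(i <- r) along j (F i)
    = along j (\big[@lmul _ _/@lone _ _]_(i <- r) F i).
Proof.
elim: r => [|i r IH]; first by rewrite !big_nil -along_lone.
by rewrite !big_cons IH along_lmul.
Qed.

(** Series in distinct variables multiply without any summation: in the product
    of [F_j(y_j)] with a series not involving [y_j], the exponent of [y_j] must
    come entirely from the first factor, so one term survives. *)
Lemma along_prod (r : seq 'I_M) (F : 'I_M -> lseries int A) a : uniq r ->
  (\big[@lmul _ _/@lone _ _]_(j <- r) along j (F j)) a
  = if [forall i, (i \notin r) ==> (a i == 0)] then \prod_(j <- r) F j (a j) else 0.
Proof.
elim: r a => [|j r IH] a /=.
  move=> _; rewrite !big_nil /lone; have [->|a0] := eqVneq a 0.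
    by rewrite ifT //; apply/forallP => i; rewrite !ffunE.
  rewrite ifF //; apply: contra_neqF a0 => /forallP a0; apply/ffunP => i.
  by rewrite ffunE; exact/eqP/a0.
case/andP=> jr ru; rewrite !big_cons (@lmul_finsum _ _ [:: axis j (a j)]) //; last first.
  move=> b; rewrite inE => bj.
  have [bE|/along_neq->] := eqVneq b (axis j (b j)); last by rewrite mul0r.
  rewrite IH // ifF ?mulr0 //; apply/negP => /forallP/(_ j).
  rewrite jr /= !ffunE subr_eq0 => /eqP aj.
  by move: bj; rewrite aj -bE eqxx.
rewrite big_seq1 along_axis IH //.
have aE i : i != j -> (a - axis j (a j)) i = a i.
  by move=> /negbTE ij; rewrite !ffunE ij subr0.
have -> : \prod_(i <- r) F i ((a - axis j (a j)) i) = \prod_(i <- r) F i (a i).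
  rewrite !big_seq; apply: eq_bigr => i ir; rewrite aE //.
  by apply: contraNneq jr => <-.
rewrite (_ : [forall i, _] = [forall i, (i \notin j :: r) ==> (a i == 0)]).
  by case: ifP => //; rewrite mulr0.
apply: eq_forallb => i; rewrite inE negb_or; case: (eqVneq i j) => [->|ij] /=.
  by rewrite jr !ffunE eqxx subrr eqxx.
by rewrite aE.
Qed.

End Axis.

(** * Polynomials acting on Laurent series *)

Section PolynomialAction.
Variables (A : comNzRingType) (M : nat).
Local Notation E := {ffun 'I_M -> int}.
Implicit Types (p q : {mpoly A[M]}) (H : lseries E A) (a : E).

Definition mexp (m : 'X_{1..M}) : E := [ffun i => (m i)%:Z].

(** The product of the polynomial [p] in [y_1, ..., y_M] with the series [H]. The
    sum runs over the monomials of [p], so that it is linear in [p] for every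
    [H]. *)
Definition mact p H : lseries E A :=
  fun a => \sum_(m <- msupp p) p@_m * H (a - mexp m).

(** An index set that is common to several polynomials, as needed to compare
    their actions termwise. *)
Lemma mactE k p H a : (msize p <= k)%N ->
  mact p H a = \sum_(m : 'X_{1..M < k}) p@_m * H (a - mexp m).
Proof.
move=> le_pk; set I : subFinType _ := 'X_{1..M < k}.
rewrite /mact (big_mksub I) ?msupp_uniq //=; first last.
  by move=> x /msize_mdeg_lt /leq_trans; apply.
by rewrite big_rmcond //= => m /memN_msupp_eq0 ->; rewrite mul0r.
Qed.

Lemma mactD p q H a : mact (p + q) H a = mact p H a + mact q H a.
Proof.
pose k := maxn (msize (p + q)) (maxn (msize p) (msize q)).
rewrite !(@mactE k) ?leq_max ?leqnn ?orbT // -big_split /=.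
by apply: eq_bigr => m _; rewrite mcoeffD mulrDl.
Qed.

Lemma mactZ c p H a : mact (c *: p) H a = c * mact p H a.
Proof.
pose k := maxn (msize (c *: p)) (msize p).
rewrite !(@mactE k) ?leq_max ?leqnn ?orbT // mulr_sumr.
by apply: eq_bigr => m _; rewrite mcoeffZ mulrA.
Qed.

Lemma mactB p q H a : mact (p - q) H a = mact p H a - mact q H a.
Proof. by rewrite mactD -scaleN1r mactZ mulN1r. Qed.

Lemma mact0 H a : mact 0 H a = 0.
Proof. by rewrite /mact msupp0 big_nil. Qed.

Lemma mact_sum (I : Type) (r : seq I) (P : pred I) (p : I -> {mpoly A[M]}) H a :
  mact (\sum_(i <- r | P i) p i) H a = \sum_(i <- r | P i) mact (p i) H a.
Proof. by apply: (big_morph (fun p => mact p H a)) => [q q'|]; rewrite ?mactD ?mact0. Qed.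

Lemma mactX m H a : mact 'X_[m] H a = H (a - mexp m).
Proof. by rewrite /mact msuppX big_seq1 mcoeffX eqxx mul1r. Qed.

Lemma mact1 H a : mact 1 H a = H a.
Proof.
rewrite -mpolyX0 mactX; congr H.
by apply/ffunP => i; rewrite !ffunE mnm0E subr0.
Qed.

Lemma mactMX i p H a : mact ('X_i * p) H a = mact p H (a - evar i).
Proof.
rewrite [p]mpolyE mulr_sumr !mact_sum; apply: eq_bigr => m _.
rewrite -scalerAr -mpolyXD !mactZ !mactX; congr (_ * H _).
apply/ffunP => j; rewrite !ffunE mnmDE mnm1E PoszD opprD addrA [j == i]eq_sym.
by [].
Qed.

(** Each factor [1 - y_l/y_j] equals [y_j^(-1) (y_j - y_l)]: clearing the
    denominators turns the product of binomials into a polynomial, at the price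
    of shifting the exponent by the sum of the [evar j]. The finiteness of the
    support is proved along because the induction step needs it for
    associativity. *)
Lemma lmul_lbinom_prod (r : seq ('I_M * 'I_M)) H a :
  all (fun jl => jl.1 != jl.2) r ->
  lfin (\big[@lmul _ _/@lone E A]_(jl <- r) lbinom (-1) (evar jl.2 - evar jl.1)) /\
  lmul (\big[@lmul _ _/@lone _ _]_(jl <- r) lbinom (-1) (evar jl.2 - evar jl.1)) H a
  = mact (\prod_(jl <- r) ('X_(jl.1) - 'X_(jl.2))) H
         (a + \sum_(jl <- r) evar jl.1).
Proof.
elim: r a => [|[j l] r IH] a /=.
  by move=> _; rewrite !big_nil lmul_lone mact1 addr0; split=> //; exact: lfin_lone.
case/andP=> jl /IH{}IH; rewrite !big_cons /=.
have e0 : evar l - evar j != 0.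
  apply: contra_neq jl => /ffunP/(_ j); rewrite !ffunE eqxx.
  by case: eqP.
have [fin _] := IH 0; split; first exact: lfin_lbinom.
rewrite lmul_lbinomA // lmul_lbinom //.
have [_ ->] := IH a; have [_ ->] := IH (a - (evar l - evar j)).
rewrite mulN1r mulrBl mactB !mactMX; congr (mact _ _ _ - mact _ _ _).
  by rewrite addrCA [_ + (_ + _)]addrC addrK.
by rewrite opprB !addrA [LHS]addrAC.
Qed.

End PolynomialAction.

(** * The Jacobi-Trudi determinant *)

Section JacobiTrudi.
Variables (A : comNzRingType) (M : nat).
Local Notation E := {ffun 'I_M -> int}.

(** The Vandermonde determinant of the variables in reverse order
    [X_(M-1), ..., X_0]: the reversal turns its factors [a_j - a_i], [i < j],
    into [X_j - X_i] with [j < i], with no sign to keep track of. *)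
Lemma vandermonde_monomials :
  \prod_(p : 'I_M * 'I_M | (p.1 < p.2)%N) ('X_(p.1) - 'X_(p.2) : {mpoly A[M]})
  = \sum_(s : 'S_M) (-1) ^+ s *: 'X_[[multinom (s (rev_ord i) : nat) | i < M]].
Proof.
rewrite -(pair_big_dep xpredT (fun i j : 'I_M => (i < j)%N)
            (fun i j => 'X_i - 'X_j)) /=.
transitivity (\det (Vandermonde M (\row_(j < M) ('X_(rev_ord j) : {mpoly A[M]})))).
  rewrite det_Vandermonde (exchange_big_dep xpredT) //= [RHS](reindex_inj rev_ord_inj) /=.
  apply: eq_bigr => i _; rewrite [RHS](reindex_inj rev_ord_inj) /=.
  apply: eq_big => j; last by rewrite !mxE !rev_ordK.
  have := ltn_ord i; have := ltn_ord j.
  by move=> jM iM; rewrite ltn_sub2lE // ltnS.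
rewrite -det_tr; apply: eq_bigr => s _.
rewrite -mul_mpolyC rmorph_sign; congr (_ * _).
rewrite [RHS]mpolyXE_id (reindex_inj rev_ord_inj) /=.
by apply: eq_bigr => i _; rewrite !mxE mnmE rev_ordK.
Qed.

(** The exponent [delta] of the denominators: [y_i] is the denominator of
    [y_l/y_i] for each of the [M - 1 - i] indices [l > i]. *)
Lemma sum_evar_lt :
  \sum_(p : 'I_M * 'I_M | (p.1 < p.2)%N) evar p.1
  = [ffun i : 'I_M => (rev_ord i : nat)%:Z] :> E.
Proof.
apply/ffunP => i; rewrite sum_ffunE !ffunE.
rewrite -(pair_big_dep xpredT (fun i j : 'I_M => (i < j)%N)
            (fun j _ => (evar j : E) i)) /=.
rewrite (bigD1 i) //= [X in _ + X]big1 ?addr0; last first.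
  by move=> j ji; rewrite big1 // => l _; rewrite ffunE eq_sym (negbTE ji).
under eq_bigr do rewrite ffunE eqxx.
rewrite -(big_geq_mkord i.+1 M xpredT (fun=> 1%:Z)) /= sumr_const_nat.
by rewrite natz.
Qed.

(** The same permutation acts on rows and columns, so its sign cancels. *)
Lemma det_rev (B : 'M[A]_M) :
  \det (\matrix_(i, j) B (rev_ord i) (rev_ord j)) = \det B.
Proof.
pose p := perm (@rev_ord_inj M).
have -> : \matrix_(i, j) B (rev_ord i) (rev_ord j) = row_perm p (col_perm p B).
  by apply/matrixP => i j; rewrite !mxE !permE.
rewrite row_permE col_permE !det_mulmx !det_perm odd_permV mulrC -mulrA.
by rewrite -expr2 sqrr_sign mulr1.
Qed.

(** The permutation [s] of the Vandermonde expansion contributes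
    [prod_i g (a_i + (M-1-i) - s (M-1-i))], which is the [s]-term of the
    Leibniz formula for the matrix [g (a_i - i + j)] with its rows and columns
    reversed. *)
Lemma jacobi_trudi (g : lseries int A) (H : lseries E A) (a : E) :
  (forall b : E, H b = \prod_(j < M) g (b j)) ->
  lmul (\big[@lmul _ _/@lone E A]_(p : 'I_M * 'I_M | (p.1 < p.2)%N)
          lbinom (-1) (evar p.2 - evar p.1)) H a
  = \det (\matrix_(i < M, j < M) g (a i - i%:Z + j%:Z)).
Proof.
move=> HE; rewrite -big_filter.
have [|_ ->] := @lmul_lbinom_prod A M
    [seq p : 'I_M * 'I_M <- index_enum _ | (p.1 < p.2)%N] H a.
  by apply/allP => -[j l]; rewrite mem_filter /= => /andP[/ltn_eqF jl _]; apply/negbT.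
rewrite !big_filter vandermonde_monomials sum_evar_lt -det_rev mact_sum.
apply: eq_bigr => s _; rewrite mactZ mactX HE; congr (_ * _).
rewrite (reindex_inj rev_ord_inj) /=; apply: eq_bigr => i _.
rewrite !mxE; congr g; rewrite !ffunE mnmE rev_ordK /= -!addrA; congr (_ + _).
have /(congr1 val) /= -> := rev_ordK i.
rewrite -!subzn // opprB addrA subrK !intS opprD addrACA subrr add0r.
by [].
Qed.

(** Below row [L] the matrix is [g (j - i)]: zero for [j < i] and 1 for [j = i].
    So it is block upper triangular with a unitriangular second block. *)
Lemma det_jacobi_trudi_size (g : lseries int A) (L d : nat) (la : nat -> nat) :
  normalized g -> (forall i, (L <= i)%N -> la i = 0%N) ->
  \det (\matrix_(i < L + d, j < L + d) g ((la i)%:Z - i%:Z + j%:Z))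
  = \det (\matrix_(i < L, j < L) g ((la i)%:Z - i%:Z + j%:Z)).
Proof.
move=> [g0 gneg] la0.
have g_lt (i j : nat) : (L <= i)%N -> (j < i)%N -> g ((la i)%:Z - i%:Z + j%:Z) = 0.
  move=> Li ji; rewrite la0 // sub0r addrC -opprB (subzn (ltnW ji)).
  by rewrite -(prednK (n := i - j)) ?subn_gt0 // -NegzE gneg.
set B := \matrix_(i < L + d, j < L + d) _.
have dl0 : dlsubmx B = 0.
  apply/matrixP => i j; rewrite !mxE /= g_lt ?leq_addr //.
  exact: leq_trans (ltn_ord j) (leq_addr _ _).
rewrite -[B]submxK dl0 det_ublock [X in _ * X](_ : _ = 1) ?mulr1.
  by congr (\det _); apply/matrixP => i j; rewrite !mxE.
rewrite -det_tr det_trig.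
  by rewrite big1 // => i _; rewrite !mxE la0 ?leq_addr // sub0r addNr.
by apply/is_trig_mxP => i j ij; rewrite !mxE g_lt ?leq_addr //= ltn_add2l.
Qed.

End JacobiTrudi.

(** * The one-variable generating functions and the sign change *)

Section NegXt.
Variables (R : comNzRingType) (n nt : nat).

(** Names the substitution, so that [neg_xt] is seen as the ring morphism
    [comp_mpoly] of it. *)
Definition neg_xt_tuple : (n + nt).-tuple {mpoly R[n + nt]} :=
  [tuple match split v with inl i => xvar R nt i | inr k => - xtvar R n k end
  | v < n + nt].

Lemma neg_xtE p : neg_xt p = comp_mpoly neg_xt_tuple p.
Proof. by []. Qed.

Lemma neg_xt_xvar (i : 'I_n) : neg_xt (xvar R nt i) = xvar R nt i.
Proof.
by rewrite /neg_xt comp_mpolyXU -tnth_nth tnth_mktuple (unsplitK (inl _ i)).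
Qed.

Lemma neg_xt_xtvar (i : 'I_nt) : neg_xt (xtvar R n i) = - xtvar R n i.
Proof.
by rewrite /neg_xt comp_mpolyXU -tnth_nth tnth_mktuple (unsplitK (inr _ i)).
Qed.

(** The series [g(y)] of which the generating function of the [f_a] contains one
    copy in each variable [y_j]. *)
Definition f_var_genfun : lseries int {mpoly R[n + nt]} :=
  lmul (\big[@lmul _ _/@lone _ _]_(I < nt) lbinom (- xtvar R n I) 1)
       (\big[@lmul _ _/@lone _ _]_(i < n) lgeom (xvar R nt i) 1).

Lemma normalized_f_var_genfun : normalized f_var_genfun.
Proof.
apply: normalized_lmul; apply: normalized_big => i.
  exact: normalized_lbinom.
exact: normalized_lgeom.
Qed.

Lemma neg_xt_genfun k : neg_xt (f_var_genfun k) = s_poly R n nt k.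
Proof.
have fE : @neg_xt R n nt \o f_var_genfun = s_genfun R n nt.
  rewrite /s_genfun lmulC.
  apply: (@map_lmul _ _ (comp_mpoly neg_xt_tuple)).
  1-4: by apply: normalized_big => i; do [exact: normalized_lbinom | exact: normalized_lgeom].
    apply: map_lmul_big => i; [exact: normalized_lbinom | exact: normalized_lbinom |].
    by rewrite map_lbinom rmorphN /= -neg_xtE neg_xt_xtvar opprK.
  apply: map_lmul_big => i; [exact: normalized_lgeom | exact: normalized_lgeom |].
  by rewrite map_lgeom /= -neg_xtE neg_xt_xvar.
rewrite /s_poly -fE /=; case: k => //= k.
by rewrite normalized_f_var_genfun.2 neg_xtE rmorph0.
Qed.

Lemma f_polyE (M : nat) (a : {ffun 'I_M -> int}) :
  f_poly R n nt a = \det (\matrix_(i < M, j < M) f_var_genfun (a i - i%:Z + j%:Z)).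
Proof.
rewrite /f_poly /f_genfun; apply: jacobi_trudi => b.
under eq_bigr => j _.
  under eq_bigr do rewrite along_lbinom.
  under [X in lmul _ X]eq_bigr do rewrite along_lgeom.
  rewrite !along_big along_lmul; over.
rewrite along_prod ?index_enum_uniq // ifT //.
by apply/forallP => i; rewrite mem_index_enum.
Qed.

End NegXt.

(** * Super Schur polynomials *)

(** The parts of a partition decrease, so its first zero part, whose index is the
    number of positive parts, is followed by zeros only. *)
Lemma nth_plength (la : seq nat) i :
  is_partition la -> (plength la <= i)%N -> nth 0%N la i = 0%N.
Proof.
rewrite /is_partition sorted_pairwise; last by move=> y x z yx zy; exact: leq_trans zy yx.
elim: la i => [|x la IH] i; first by rewrite nth_nil.
case/andP=> /allP xla pla; rewrite /plength /=.
case: (posnP x) xla => [->|x0] xla.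
  rewrite add0n => _; case: i => [//|i] /=.
  have [ila|/(nth_default 0%N)->//] := ltnP i (size la).
  by apply/eqP; rewrite -leqn0; apply/xla/mem_nth.
by case: i => [//|i]; rewrite add1n ltnS /=; apply: IH.
Qed.

Theorem proposition5p1 (R : comNzRingType) (n nt : nat) (la : seq nat) (M : nat)
    (hla : is_partition la) (hM : (0 < M)%N) (hlaM : (plength la <= M)%N) :
  neg_xt (f_poly R n nt (pad M la)) = super_schur R n nt la.
Proof.
rewrite f_polyE.
have -> : \matrix_(i < M, j < M) f_var_genfun R n nt (pad M la i - i%:Z + j%:Z)
        = \matrix_(i < M, j < M) f_var_genfun R n nt ((nth 0%N la i)%:Z - i%:Z + j%:Z).
  by apply/matrixP => i j; rewrite !mxE ffunE.
rewrite -(subnKC hlaM) det_jacobi_trudi_size; first last.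
- by move=> i; exact: nth_plength.
- exact: normalized_f_var_genfun.
rewrite neg_xtE -det_map_mx; congr (\det _).
by apply/matrixP => i j; rewrite !mxE; exact: neg_xt_genfun.
Qed.
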